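(* Let $P\subseteq\{\{T_\Box,T_\Diamond\},\{4_\Box,4_\Diamond\},\{B_1,B_2\},\{5_1,5_2\},\{D\}\}$, let $\mathcal{P}$ be the corresponding set of frame conditions (reflexivity for $\{T_\Box,T_\Diamond\}$, transitivity for $\{4_\Box,4_\Diamond\}$, symmetry for $\{B_1,B_2\}$, euclideanity for $\{5_1,5_2\}$, seriality for $D$), and let $\mathcal{GK}^c_P$ be $\mathcal{GK}^c$ extended with all axiom schemes in $\bigcup P$. Then $\mathcal{GK}^c_P$ is strongly complete with respect to the crisp Gödel–Kripke models whose accessibility relation satisfies the conditions in $\mathcal{P}$: for every set $\Gamma\cup\{\varphi\}\subseteq\mathcal{L}_{\Box\Diamond}(V)$, $\Gamma\vdash_{\mathcal{GK}^c_P}\varphi$ iff for every such model and every world $v$, $e(v,\gamma)=1$ for all $\gamma\in\Gamma$ implies $e(v,\varphi)=1$.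
   Context: $V$ is a countable set of propositional variables. $\mathcal{L}_{\Box\Diamond}(V)$ is the set of formulas built from $V$ and $\bot$ with $\wedge,\vee,\rightarrow$ and unary $\Box,\Diamond$; $\top:=\bot\to\bot$, $\neg\varphi:=\varphi\to\bot$. In $[0,1]_G$: $\wedge=\min$, $\vee=\max$, $a\to b=1$ if $a\le b$ and $b$ otherwise. A crisp Gödel–Kripke model is $\langle W,R,e\rangle$ with $W\ne\emptyset$, $R\subseteq W\times W$, $e:V\times W\to[0,1]$, extended by $e(v,\bot)=0$, truth-functionally via $[0,1]_G$ for $\wedge,\vee,\to$, $e(v,\Box\varphi)=\inf\{e(w,\varphi):Rvw\}$ ($\inf\emptyset=1$), $e(v,\Diamond\varphi)=\sup\{e(w,\varphi):Rvw\}$ ($\sup\emptyset=0$). Frame conditions (reflexive, transitive, symmetric, euclidean, serial) are the classical ones on $R$. $\mathcal{GK}^c$: Gödel–Dummett propositional calculus (intuitionistic calculus plus prelinearity $(\varphi\to\psi)\vee(\psi\to\varphi)$, modus ponens) over $\mathcal{L}_{\Box\Diamond}(V)$, plus axioms $\Box(\varphi\to\psi)\to(\Box\varphi\to\Box\psi)$, $\Diamond(\varphi\vee\psi)\to(\Diamond\varphi\vee\Diamond\psi)$, $\Diamond(\varphi\to\psi)\to(\Box\varphi\to\Diamond\psi)$, $(\Diamond\varphi\to\Box\psi)\to\Box(\varphi\to\psi)$, $\neg\Diamond\bot$, $\Box(\varphi\vee\psi)\to(\Box\varphi\vee\Diamond\psi)$, and rules applicable only to theorems: from $\varphi$ infer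 $\Box\varphi$; from $\varphi\to\psi$ infer $\Diamond\varphi\to\Diamond\psi$. Axiom schemes: $T_\Box:\ \Box\varphi\to\varphi$; $T_\Diamond:\ \varphi\to\Diamond\varphi$; $4_\Box:\ \Box\varphi\to\Box\Box\varphi$; $4_\Diamond:\ \Diamond\Diamond\varphi\to\Diamond\varphi$; $B_1:\ \varphi\to\Box\Diamond\varphi$; $B_2:\ \Diamond\Box\varphi\to\varphi$; $5_1:\ \Diamond\varphi\to\Box\Diamond\varphi$; $5_2:\ \Diamond\Box\varphi\to\Box\varphi$; $D:\ \Diamond\top$. *)

(* Defs.v *)
From Corelib Require Import RelationClasses.
From mathcomp Require Import all_boot all_order all_algebra.
From mathcomp Require Import boolp classical_sets reals.

Set Implicit Arguments.
Unset Strict Implicit.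
Unset Printing Implicit Defensive.

Import Order.TTheory GRing.Theory Num.Theory.

Local Open Scope classical_set_scope.
Local Open Scope ring_scope.

Inductive modal_form (V : Type) : Type :=
  | Var of V
  | Bot
  | And of modal_form V & modal_form V
  | Or of modal_form V & modal_form V
  | Imp of modal_form V & modal_form V
  | Box of modal_form V
  | Dia of modal_form V.

Arguments Bot {V}.

Declare Scope modal_scope.
Delimit Scope modal_scope with M.
Bind Scope modal_scope with modal_form.

Notation "A && B" := (And A B) : modal_scope.
Notation "A || B" := (Or A B) : modal_scope.
Notation "A ==> B" := (Imp A B) : modal_scope.
Notation "~~ A" := (Imp A Bot) : modal_scope.

Definition Top {V : Type} : modal_form V := Imp Bot Bot.

Inductive gkc_axiom (V : Type) : modal_form V -> Prop :=
  | ax_k A B : gkc_axiom (A ==> (B ==> A))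
  | ax_s A B C : gkc_axiom ((A ==> (B ==> C)) ==> ((A ==> B) ==> (A ==> C)))
  | ax_andl A B : gkc_axiom (A && B ==> A)
  | ax_andr A B : gkc_axiom (A && B ==> B)
  | ax_and A B : gkc_axiom (A ==> (B ==> A && B))
  | ax_orl A B : gkc_axiom (A ==> A || B)
  | ax_orr A B : gkc_axiom (B ==> A || B)
  | ax_or A B C : gkc_axiom ((A ==> C) ==> ((B ==> C) ==> (A || B ==> C)))
  | ax_bot A : gkc_axiom (Bot ==> A)
  | ax_prelin A B : gkc_axiom ((A ==> B) || (B ==> A))
  | ax_K_box A B : gkc_axiom (Box (A ==> B) ==> (Box A ==> Box B))
  | ax_K_dia A B : gkc_axiom (Dia (A || B) ==> Dia A || Dia B)
  | ax_FS1 A B : gkc_axiom (Dia (A ==> B) ==> (Box A ==> Dia B))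
  | ax_FS2 A B : gkc_axiom ((Dia A ==> Box B) ==> Box (A ==> B))
  | ax_dia_bot : gkc_axiom (~~ Dia Bot)
  | ax_Cr A B : gkc_axiom (Box (A || B) ==> Box A || Dia B).

(* Names of the five sets of additional schemes {T_box, T_dia},
   {4_box, 4_dia}, {B1, B2}, {5_1, 5_2} and {D}. *)
Inductive extension : Set := ExtT | Ext4 | ExtB | Ext5 | ExtD.

Inductive ext_axiom (V : Type) : extension -> modal_form V -> Prop :=
  | ax_T_box A : ext_axiom ExtT (Box A ==> A)
  | ax_T_dia A : ext_axiom ExtT (A ==> Dia A)
  | ax_4_box A : ext_axiom Ext4 (Box A ==> Box (Box A))
  | ax_4_dia A : ext_axiom Ext4 (Dia (Dia A) ==> Dia A)
  | ax_B1 A : ext_axiom ExtB (A ==> Box (Dia A))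
  | ax_B2 A : ext_axiom ExtB (Dia (Box A) ==> A)
  | ax_5_1 A : ext_axiom Ext5 (Dia A ==> Box (Dia A))
  | ax_5_2 A : ext_axiom Ext5 (Dia (Box A) ==> Box A)
  | ax_D : ext_axiom ExtD (Dia Top).

(* Derivability from the premises [Gamma]. The two modal rules apply to
   theorems only, i.e. to formulas derivable from the empty set of premises. *)
Inductive derives (V : Type) (P : set extension) (Gamma : set (modal_form V)) :
    modal_form V -> Prop :=
  | der_prem A : Gamma A -> derives P Gamma A
  | der_gkc A : gkc_axiom A -> derives P Gamma A
  | der_ext x A : P x -> ext_axiom x A -> derives P Gamma A
  | der_mp A B : derives P Gamma (A ==> B) -> derives P Gamma A ->
      derives P Gamma B
  | der_box A : derives P set0 A -> derives P Gamma (Box A)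
  | der_dia A B : derives P set0 (A ==> B) ->
      derives P Gamma (Dia A ==> Dia B).

Definition euclidean (W : Type) (acc : W -> W -> Prop) : Prop :=
  forall u v w, acc u v -> acc u w -> acc v w.

Definition serial (W : Type) (acc : W -> W -> Prop) : Prop :=
  forall v, exists w, acc v w.

Definition frame_condition (x : extension) (W : Type)
    (acc : W -> W -> Prop) : Prop :=
  match x with
  | ExtT => Reflexive acc
  | Ext4 => Transitive acc
  | ExtB => Symmetric acc
  | Ext5 => euclidean acc
  | ExtD => serial acc
  end.

Record crisp_model (R : realType) (V : Type) := CrispModel {
  world :> Type;
  world_inhabited : inhabited world;
  access : world -> world -> Prop;
  valuation : V -> world -> R;
  valuation_itv : forall p v, 0 <= valuation p v <= 1 }.

Arguments access {R V} _ _ _.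
Arguments valuation {R V} _ _ _.

Definition godel_imp (R : realType) (a b : R) : R := if a <= b then 1 else b.

(* Infimum and supremum in the complete lattice [0, 1], for sets included in
   [0, 1]; the real [inf] sends the empty set to 0, hence the case split. *)
Definition inf01 (R : realType) (A : set R) : R :=
  if A == set0 then 1 else inf A.

Definition sup01 (R : realType) (A : set R) : R :=
  if A == set0 then 0 else sup A.

Fixpoint geval (R : realType) (V : Type) (M : crisp_model R V) (v : M)
    (A : modal_form V) : R :=
  match A with
  | Var p => valuation M p v
  | Bot => 0
  | And B C => Num.min (geval v B) (geval v C)
  | Or B C => Num.max (geval v B) (geval v C)
  | Imp B C => godel_imp (geval v B) (geval v C)
  | Box B => inf01 [set geval w B | w in [set w | access M v w]]
  | Dia B => sup01 [set geval w B | w in [set w | access M v w]]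
  end.

(* Main.v *)
(* Soundness is a residuation argument in [0, 1]. For completeness, the model
   made of all homomorphisms into [0, 1] does not work: a world may have box
   values increasing to, and diamond values decreasing to, one and the same
   real, while its modal theory requires its successors to separate two values
   lying in between. Instead, we build countably many worlds together with a
   single abstract linear preorder comparing the values of formulas at all of
   them. A world is a prime theory; a successor avoiding prescribed formulas
   exists because of the axiom [Box (A || B) ==> Box A || Dia B], and the
   linear order of its values can be amalgamated with the order built so far.
   Dovetailing, every lower approximation of a diamond value and every upper
   approximation of a box value is met, in the final order, by some successor.
   The countable order is then embedded into [0, 1] by repeated bisection, in
   a way that preserves all existing infima and suprema. *)

Require Import Defs.
From HB Require Import structures.
From mathcomp Require Import all_boot all_order all_algebra lra.
From mathcomp Require Import boolp classical_sets reals.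

Set Implicit Arguments.
Unset Strict Implicit.
Unset Printing Implicit Defensive.

Import Order.TTheory GRing.Theory Num.Theory.

Local Open Scope ring_scope.

(** * Theories of the calculus *)

Section Theories.
Local Open Scope classical_set_scope.
Local Open Scope modal_scope.
Context {V : Type} (P : set extension).
Implicit Types (A B C D : modal_form V) (S T : set (modal_form V)).

(** Only modus ponens is a closure condition: the modal rules act on theorems alone, and the first
    clause already contains all of these. *)
Definition theory T :=
  (forall A, derives P set0 A -> T A) /\
  (forall A B, T (A ==> B) -> T A -> T B).

Definition prime_theory T :=
  [/\ theory T, ~ T Bot & forall A B, T (A || B) -> T A \/ T B].

Lemma derives_mono Gamma Delta A :
  Gamma `<=` Delta -> derives P Gamma A -> derives P Delta A.
Proof.
move=> sub d; elim: d Delta sub => {Gamma A} => [Gamma A GA|Gamma A ax|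
  Gamma x A Px ax|Gamma A B _ IH1 _ IH2|Gamma A d _|Gamma A B d _] Delta sub.
- exact/der_prem/sub.
- exact: der_gkc.
- exact: der_ext Px ax.
- exact: der_mp (IH1 _ sub) (IH2 _ sub).
- exact: der_box.
- exact: der_dia.
Qed.

Lemma derives_theory Gamma : theory (derives P Gamma).
Proof.
by split=> [A|A B]; [exact: derives_mono | exact: der_mp].
Qed.

Lemma theory_ax T A : theory T -> gkc_axiom A -> T A.
Proof. by move=> [thm _] ax; apply: thm; apply: der_gkc. Qed.

Lemma theory_mp T A B : theory T -> T (A ==> B) -> T A -> T B.
Proof. by move=> [_]; apply. Qed.

Lemma theory_mp2 T A B C :
  theory T -> T (A ==> (B ==> C)) -> T A -> T B -> T C.
Proof. by move=> thT abc /(theory_mp thT abc); apply: theory_mp. Qed.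

Lemma imp_refl T A : theory T -> T (A ==> A).
Proof.
move=> thT; apply: (theory_mp2 thT (theory_ax thT (ax_s A (A ==> A) A)));
  exact: theory_ax thT (ax_k _ _).
Qed.

Lemma imp_theory T A : theory T -> theory [set B | T (A ==> B)].
Proof.
move=> thT; split=> [B dB|B C] /=.
  by apply: (theory_mp thT (theory_ax thT (ax_k B A)) _); apply: thT.1.
exact: theory_mp2 thT (theory_ax thT (ax_s A B C)).
Qed.

(** Deduction theorem: [[set C | T (A ==> C)]] is a theory containing [T] and [A], so the premise
    can be applied to it. Propositional derivations below thus become arguments inside arbitrary
    extensions of [T]. *)
Lemma imp_intro T A B : theory T ->
  (forall T', theory T' -> T `<=` T' -> T' A -> T' B) -> T (A ==> B).
Proof.
move=> thT /(_ [set C | T (A ==> C)]); apply.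
- exact: imp_theory.
- by move=> C TC; apply: (theory_mp thT (theory_ax thT (ax_k C A)) TC).
- exact: imp_refl.
Qed.

Lemma imp_trans T A B C :
  theory T -> T (A ==> B) -> T (B ==> C) -> T (A ==> C).
Proof.
move=> thT ab bc; apply: imp_intro => // T' thT' sub a.
by apply: (theory_mp thT' (sub _ bc) _); apply: (theory_mp thT' (sub _ ab) a).
Qed.

Lemma imp_const T A B : theory T -> T B -> T (A ==> B).
Proof. by move=> thT; apply: (theory_mp thT (theory_ax thT (ax_k B A))). Qed.

Lemma theory_top T : theory T -> T Top.
Proof. exact: imp_refl. Qed.

Lemma imp_top T A : theory T -> T (A ==> Top).
Proof. by move=> thT; apply: imp_const => //; apply: theory_top. Qed.

Lemma top_imp T A : theory T -> T (Top ==> A) <-> T A.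
Proof.
move=> thT; split=> [h|]; last exact: imp_const.
exact: theory_mp thT h (theory_top thT).
Qed.

Lemma and_intro T A B : theory T -> T A -> T B -> T (A && B).
Proof. by move=> thT; apply: (theory_mp2 thT (theory_ax thT (ax_and A B))). Qed.

Lemma and_l T A B : theory T -> T (A && B) -> T A.
Proof. by move=> thT; apply: (theory_mp thT (theory_ax thT (ax_andl A B))). Qed.

Lemma and_r T A B : theory T -> T (A && B) -> T B.
Proof. by move=> thT; apply: (theory_mp thT (theory_ax thT (ax_andr A B))). Qed.

Lemma or_l T A B : theory T -> T A -> T (A || B).
Proof. by move=> thT; apply: (theory_mp thT (theory_ax thT (ax_orl A B))). Qed.

Lemma or_r T A B : theory T -> T B -> T (A || B).
Proof. by move=> thT; apply: (theory_mp thT (theory_ax thT (ax_orr A B))). Qed.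

Lemma or_elim T A B C :
  theory T -> T (A ==> C) -> T (B ==> C) -> T (A || B ==> C).
Proof. by move=> thT; apply: (theory_mp2 thT (theory_ax thT (ax_or A B C))). Qed.

Lemma or_case T A B C : theory T -> T (A || B) ->
  (forall T', theory T' -> T `<=` T' -> T' A -> T' C) ->
  (forall T', theory T' -> T `<=` T' -> T' B -> T' C) -> T C.
Proof.
move=> thT ab ac bc; apply: (theory_mp thT _ ab).
by apply: or_elim => //; apply: imp_intro.
Qed.

(** Membership in all theories expresses theoremhood, since the set of theorems is itself a theory;
    this is what licenses necessitation. *)
Lemma box_mono T A B : theory T -> (forall T', theory T' -> T' (A ==> B)) ->
  T (Box A ==> Box B).
Proof.
move=> thT ab; apply: (theory_mp thT (theory_ax thT (ax_K_box A B)) _).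
by apply: thT.1; apply: der_box; apply: ab; apply: derives_theory.
Qed.

Lemma dia_mono T A B : theory T -> (forall T', theory T' -> T' (A ==> B)) ->
  T (Dia A ==> Dia B).
Proof.
by move=> thT ab; apply: thT.1; apply: der_dia; apply: ab; apply: derives_theory.
Qed.

Lemma box_thm T A : theory T -> (forall T', theory T' -> T' A) -> T (Box A).
Proof. by move=> thT a; apply: thT.1; apply: der_box; apply: a; apply: derives_theory. Qed.

Lemma box_and T A B : theory T -> T (Box A ==> (Box B ==> Box (A && B))).
Proof.
move=> thT; have h : T (Box A ==> Box (B ==> A && B)).
  by apply: box_mono => // T' thT'; apply: (theory_ax thT' (ax_and _ _)).
exact: imp_trans h (theory_ax thT (ax_K_box _ _)).
Qed.

(** [A] implies [(A ==> B) ==> B]; monotonicity of [Dia] followed by the axiom [ax_FS1] then yields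
    [Dia B] from [Dia A] and [Box (A ==> B)]. *)
Lemma box_imp_dia T A B :
  theory T -> T (Box (A ==> B)) -> T (Dia A ==> Dia B).
Proof.
move=> thT ab; have h : T (Dia A ==> Dia ((A ==> B) ==> B)).
  apply: dia_mono => // T1 th1; apply: imp_intro => // T2 th2 _ a.
  by apply: imp_intro => // T3 th3 sub f; apply: (theory_mp th3 f (sub _ a)).
apply: imp_intro => // T1 th1 sub da.
apply: (theory_mp2 th1 (theory_ax th1 (ax_FS1 (A ==> B) B))); last exact: sub.
exact: theory_mp th1 (sub _ h) da.
Qed.

Lemma prime_total T A B :
  prime_theory T -> T (A ==> B) \/ T (B ==> A).
Proof. by move=> [thT _]; apply; apply: (theory_ax thT (ax_prelin A B)). Qed.

(** Prelinearity is applied to [A] and [A ==> B]: the alternative [A ==> (A ==> B)] would contract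
    to [A ==> B]. This is the second case of the Gödel implication. *)
Lemma prime_imp T A B :
  prime_theory T -> ~ T (A ==> B) -> T ((A ==> B) ==> B).
Proof.
move=> pT nab; have [thT _ _] := pT.
have [h|h] := prime_total A (A ==> B) pT.
  case: nab; apply: imp_intro => // T1 th1 sub a.
  by apply: (theory_mp2 th1 (sub _ h) a a).
apply: imp_intro => // T1 th1 sub f.
by apply: (theory_mp th1 f _); apply: (theory_mp th1 (sub _ h) f).
Qed.

(** Directedness makes avoiding the members of [Delta] one by one the same as avoiding their finite
    disjunctions, as a prime theory must. *)
Definition or_directed (Delta : set (modal_form V)) :=
  forall A B, Delta A -> Delta B ->
    exists2 C, Delta C & forall T, theory T -> T (A || B ==> C).

(** A maximal theory avoiding [Delta] is prime: if it lacks both [A] and [B], each of them implies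
    in it a member of [Delta], so [A || B] implies a common bound of the two in [Delta]. *)
Lemma lindenbaum T (Delta : set (modal_form V)) : theory T ->
  Delta !=set0 -> or_directed Delta -> (forall A, Delta A -> ~ T A) ->
  exists S, [/\ prime_theory S, T `<=` S & forall A, Delta A -> ~ S A].
Proof.
move=> thT [d0 Dd0] dir disj.
pose good S := [/\ theory S, T `<=` S & forall A, Delta A -> ~ S A].
have good_T : good T by split.
have [F subF totF|S [gS maxS]] :=
  @Zorn_bigcup (modal_form V) [set S | S = set0 \/ good S].
  have [[S0 FS0 gS0]|noF] := pselect (exists2 S, F S & good S); last first.
    left; rewrite -subset0 => A [S FS SA].
    case: (subF _ FS) => [S0|gS]; first by rewrite S0 in SA.
    by case: noF; exists S.
  have [thS0 subS0 _] := gS0.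
  right; split.
  - split=> [A dA|A B [S1 F1 ab] [S2 F2 a]]; first by exists S0 => //; apply: thS0.1.
    have gd S : F S -> forall C, S C -> theory S.
      by move=> /subF [-> //|[]].
    have [s|s] := totF _ _ F1 F2.
      by exists S2 => //; apply: (theory_mp (gd _ F2 _ a) (s _ ab) a).
    by exists S1 => //; apply: (theory_mp (gd _ F1 _ ab) ab (s _ a)).
  - by move=> A TA; exists S0 => //; apply: subS0.
  - by move=> A DA [S1 /subF [-> //|[_ _ /(_ _ DA)]]].
case: gS => [S0|gS].
  case: (maxS T); last by right.
  by rewrite S0; split=> // /(_ Top (theory_top thT)).
exists S; have [thS subS disS] := gS; split=> //; split=> //.
  move=> Sb; apply: (disS _ Dd0).
  exact: theory_mp thS (theory_ax thS (ax_bot d0)) Sb.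
have ext A : ~ S A -> exists2 D, Delta D & S (A ==> D).
  move=> nA; apply: contrapT => noD.
  case: (maxS [set B | S (A ==> B)]).
    split=> [B|sub]; first exact: imp_const.
    by apply: nA; apply: sub; apply: imp_refl.
  right; split; first exact: imp_theory.
    by move=> B TB; apply: imp_const => //; apply: subS.
  by move=> D DD SD; apply: noD; exists D.
move=> A B ab; apply: contrapT => /not_orP[/ext[C DC ac] /ext[D DD bd]].
have [E DE cde] := dir _ _ DC DD.
apply: (disS _ DE); apply: (or_case _ ab) => // T1 th1 sub h.
  apply: (theory_mp th1 (cde _ th1) (or_l _ th1 _)).
  exact: theory_mp th1 (sub _ ac) h.
apply: (theory_mp th1 (cde _ th1) (or_r _ th1 _)).
exact: theory_mp th1 (sub _ bd) h.
Qed.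

End Theories.

(** * Successors of prime theories *)

Section Successors.
Local Open Scope classical_set_scope.
Local Open Scope modal_scope.
Context {V : Type} (P : set extension).
Implicit Types (A B C D : modal_form V) (S T : set (modal_form V)).

Lemma box_theory S : theory P S -> theory P [set A | S (Box A)].
Proof.
move=> thS; split=> [A dA|A B] /=.
  by apply: thS.1; apply: der_box.
exact: (theory_mp2 thS (theory_ax thS (ax_K_box A B))).
Qed.

(* The axiom [Box (A || B) ==> Box A || Dia B] is what allows the two kinds of
   formulas to be avoided simultaneously. *)
Lemma prime_successor S (Delta : set (modal_form V)) : prime_theory P S ->
  Delta !=set0 -> or_directed P Delta -> (forall A, Delta A -> ~ S (Box A)) ->
  exists S', [/\ prime_theory P S', forall A, S (Box A) -> S' A,
    forall A, S' A -> S (Dia A) & forall A, Delta A -> ~ S' A].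
Proof.
move=> [thS nbS orS] [d0 Dd0] dir disj.
have ndb : ~ S (Dia Bot).
  by move/(theory_mp thS (theory_ax thS (ax_dia_bot _))).
(* The second disjunct keeps out every [B] that is not possible at [S]. Such [B] are closed under
   disjunction by [ax_K_dia] and primeness. *)
pose Delta' := [set C | exists A B, [/\ Delta A, ~ S (Dia B) & C = A || B]].
have [||_ _ [A1 [B1 [D1 nB1 ->]]] [A2 [B2 [D2 nB2 ->]]]|_ [A [B [DA nB ->]]] SAB|S' [pS' sub dis]] :=
    @lindenbaum _ P [set A | S (Box A)] Delta'.
- exact: box_theory.
- by exists (d0 || Bot), d0, Bot.
- have [C DC abc] := dir _ _ D1 D2.
  exists (C || (B1 || B2)).
    exists C, (B1 || B2); split=> //.
    by move/(theory_mp thS (theory_ax thS (ax_K_dia _ _)))/orS => -[].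
  move=> T thT; apply: (imp_intro thT) => T1 th1 _ h.
  apply: (or_case th1 h) => T2 th2 s2 h2; apply: (or_case th2 h2) => T3 th3 s3 h3.
  + by apply: (or_l _ th3); apply: (theory_mp th3 (abc _ th3)); apply: (or_l _ th3).
  + by apply: (or_r _ th3); apply: (or_l _ th3).
  + by apply: (or_l _ th3); apply: (theory_mp th3 (abc _ th3)); apply: (or_r _ th3).
  + by apply: (or_r _ th3); apply: (or_r _ th3).
- have := theory_mp thS (theory_ax thS (ax_Cr A B)) SAB.
  by move/orS=> [|//]; apply: disj.
have [thS' _ _] := pS'.
exists S'; split=> //.
  move=> A S'A; apply: contrapT => nSA; apply: (dis (d0 || A)).
    by exists d0, A.
  exact: (or_r _ thS').
move=> A DA S'A; apply: (dis (A || Bot)); first by exists A, Bot.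
exact: (or_l _ thS').
Qed.

(** The successor avoids [B ==> A] whenever [Box B] is strictly above [Box A] at [S]. These formulas
    are directed because the smaller of [Box B1] and [Box B2] is equivalent to [Box (B1 && B2)], by
    prelinearity. *)
Lemma box_successor S A : prime_theory P S -> ~ S (Box A) ->
  exists S', [/\ prime_theory P S', forall B, S (Box B) -> S' B,
    forall B, S' B -> S (Dia B) &
    forall B, S' (B ==> A) -> S (Box B ==> Box A)].
Proof.
move=> pS nA; have [thS _ orS] := pS.
pose Delta := [set C | exists2 B, ~ S (Box B ==> Box A) & C = B ==> A].
have [|_ _ [B1 n1 ->] [B2 n2 ->]|C [B nB ->] SBA|S' [pS' sub sup dis]] :=
    @prime_successor S Delta pS.
- exists (Top ==> A), Top => // h; apply: nA.
  by apply: (theory_mp thS h); apply: (box_thm thS) => T; apply: theory_top.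
- exists ((B1 && B2) ==> A).
    exists (B1 && B2) => // h.
    have [b12|b21] := prime_total (Box B1) (Box B2) pS.
      apply: n1; apply: (imp_intro thS) => T thT sub b1.
      apply: (theory_mp thT (sub _ h)).
      apply: (theory_mp2 thT (box_and _ _ thT) b1).
      exact: theory_mp thT (sub _ b12) b1.
    apply: n2; apply: (imp_intro thS) => T thT sub b2.
    apply: (theory_mp thT (sub _ h)).
    by apply: (theory_mp2 thT (box_and _ _ thT) (theory_mp thT (sub _ b21) b2)).
  move=> T thT; apply: (imp_intro thT) => T1 th1 _ h.
  apply: (imp_intro th1) => T2 th2 s2 b.
  apply: (or_case th2 (s2 _ h)) => T3 th3 s3 h3; apply: (theory_mp th3 h3).
    exact: and_l th3 (s3 _ b).
  exact: and_r th3 (s3 _ b).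
- by apply: nB; apply: (theory_mp thS (theory_ax thS (ax_K_box B A))).
exists S'; split=> // B S'BA; apply: contrapT => nB.
by apply: (dis (B ==> A)) => //; exists B.
Qed.

(** Dual construction: [A ==> B] is avoided whenever [Dia B] is strictly below [Dia A], and
    directedness comes from disjunctions through [ax_K_dia]. The hypothesis makes [A ==> Bot] one of
    the avoided formulas. *)
Lemma dia_successor S A : prime_theory P S -> ~ S (Dia A ==> Dia Bot) ->
  exists S', [/\ prime_theory P S', forall B, S (Box B) -> S' B,
    forall B, S' B -> S (Dia B) &
    forall B, S' (A ==> B) -> S (Dia A ==> Dia B)].
Proof.
move=> pS nA; have [thS _ orS] := pS.
pose Delta := [set C | exists2 B, ~ S (Dia A ==> Dia B) & C = A ==> B].
have [|_ _ [B1 n1 ->] [B2 n2 ->]|C [B nB ->] SBA|S' [pS' sub sup dis]] :=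
    @prime_successor S Delta pS.
- by exists (A ==> Bot), Bot.
- exists (A ==> (B1 || B2)).
    exists (B1 || B2) => // h.
    have {}h := imp_trans thS h (theory_ax thS (ax_K_dia B1 B2)).
    have [b12|b21] := prime_total (Dia B1) (Dia B2) pS.
      apply: n2; apply: (imp_trans thS h); apply: (or_elim thS b12).
      exact: imp_refl thS.
    apply: n1; apply: (imp_trans thS h); apply: (or_elim thS _ b21).
    exact: imp_refl thS.
  move=> T thT; apply: (imp_intro thT) => T1 th1 _ h.
  apply: (imp_intro th1) => T2 th2 s2 a.
  apply: (or_case th2 (s2 _ h)) => T3 th3 s3 h3.
    by apply: (or_l _ th3); apply: (theory_mp th3 h3); apply: s3.
  by apply: (or_r _ th3); apply: (theory_mp th3 h3); apply: s3.
- by apply: nB; apply: (box_imp_dia thS).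
exists S'; split=> // B S'BA; apply: contrapT => nB.
by apply: (dis (A ==> B)) => //; exists B.
Qed.

End Successors.

(** * Amalgamation of linear preorders *)

Definition total_preorder (X : Type) (le : X -> X -> Prop) :=
  (forall x y z, le x y -> le y z -> le x z) /\ (forall x y, le x y \/ le y x).

Lemma total_preorder_refl (X : Type) (le : X -> X -> Prop) (x : X) :
  total_preorder le -> le x x.
Proof. by move=> [_ tot]; case: (tot x x). Qed.

Section Glueing.
Context {X Y : Type} (leX : X -> X -> Prop) (leY : Y -> Y -> Prop).
Hypotheses (preX : total_preorder leX) (preY : total_preorder leY).
Implicit Types (U : X -> Y -> Prop) (D : Y -> X -> Prop) (a b : X) (x y : Y).

(* [U] and [D] are partial information on the order between [X] and [Y]: the
   pairs that have to satisfy [a <= x], respectively [x <= a]. *)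
Record compatible U D : Prop := Compatible {
  compat_leU : forall a b x, leX a b -> U b x -> U a x;
  compat_Ule : forall a x y, U a x -> leY x y -> U a y;
  compat_leD : forall x y a, leY x y -> D y a -> D x a;
  compat_Dle : forall x a b, D x a -> leX a b -> D x b;
  compat_UD : forall a x b, U a x -> D x b -> leX a b;
  compat_DU : forall x a y, D x a -> U a y -> leY x y }.

Definition glue U D (s t : X + Y) : Prop :=
  match s, t with
  | inl a, inl b => leX a b
  | inl a, inr x => U a x
  | inr x, inl a => D x a
  | inr x, inr y => leY x y
  end.

Lemma glue_total_preorder U D : compatible U D ->
  (forall a x, U a x \/ D x a) -> total_preorder (glue U D).
Proof.
have [trX totX] := preX; have [trY totY] := preY.
move=> [? ? ? ? ? ?] totUD; split.
  by move=> [a|x] [b|y] [c|z] /=; eauto.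
move=> [a|x] [b|y] /=; [exact: totX|exact: totUD| |exact: totY].
by case: (totUD b x) => h; [right|left].
Qed.

(** Undecided pairs are settled by placing the points of [Y] as low as possible, so [a <= x] holds
    only if forced by [U]. [compatible_high] makes the opposite choice. *)
Lemma compatible_low U D : compatible U D ->
  compatible U (fun x a => ~ U a x \/ D x a).
Proof.
have [trX totX] := preX; have [trY totY] := preY.
move=> [leU Ule leD Dle UD DU]; split => //.
- by move=> x y a xy [nU|d]; [left => /Ule/(_ xy)|right; apply: leD d].
- by move=> x a b [nU|d] ab; [left => /(leU _ _ _ ab)|right; apply: Dle ab].
- move=> a x b ax [nU|d]; last exact: UD d.
  by case: (totX a b) => // ba; case: nU; apply: leU ax.
- move=> x a y [nU|d] ay; last exact: DU ay.
  by case: (totY x y) => // yx; case: nU; apply: Ule yx.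
Qed.

Lemma compatible_high U D : compatible U D ->
  compatible (fun a x => ~ D x a \/ U a x) D.
Proof.
have [trX totX] := preX; have [trY totY] := preY.
move=> [leU Ule leD Dle UD DU]; split => //.
- by move=> a b x ab [nD|u]; [left => /Dle/(_ ab)|right; apply: leU u].
- by move=> a x y [nD|u] xy; [left => /(leD _ _ _ xy)|right; apply: Ule xy].
- move=> a x b [nD|u] xb; last exact: UD xb.
  by case: (totX a b) => // ba; case: nD; apply: Dle ba.
- move=> x a y xa [nD|u]; last exact: DU u.
  by case: (totY x y) => // yx; case: nD; apply: leD xa.
Qed.

End Glueing.

(** * Adding one world to a value order *)

Section Stages.
Local Open Scope classical_set_scope.
Local Open Scope modal_scope.
Context {V : Type} (P : set extension).
Implicit Types (A B C : modal_form V) (n k v : nat).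
Local Notation point := (nat * modal_form V)%type.
Implicit Types (le : point -> point -> Prop) (s t : point).

(* [le (n, A) (m, B)] stands for: the value of [A] at the world [n] is at most
   the value of [B] at the world [m]. *)
Record value_order le : Prop := ValueOrder {
  vo_pre : total_preorder le;
  vo_bot : forall n s, le (n, Bot) s;
  vo_top : forall n s, le s (n, Top);
  vo_prime : forall n, exists S, prime_theory P S /\
    forall A B, le (n, A) (n, B) <-> S (A ==> B) }.

(** Accessibility is the largest relation that the modal values permit; the frame conditions can
    then be read off the axioms. *)
Definition successor le n m :=
  forall A, le (n, Box A) (m, A) /\ le (m, A) (n, Dia A).

Definition agree_upto k le le' :=
  forall s t, (s.1 <= k)%N -> (t.1 <= k)%N -> le' s t <-> le s t.

Definition locate k s : point + modal_form V :=
  if (s.1 <= k)%N then inl s else inr s.2.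

(* All worlds beyond [k] become copies of one new world with theory [S]. *)
Definition extend k le S U D s t :=
  glue le (fun A B => S (A ==> B)) U D (locate k s) (locate k t).

(** [forced_up] and [forced_down] contain exactly the comparisons between old points and a new world
    with theory [S] that follow from this world being a successor of [v]. *)
Definition forced_up le S v s A :=
  exists2 B, le s (v, Box B) & S (B ==> A).

Definition forced_down le S v A s :=
  exists2 B, S (A ==> B) & le (v, Dia B) s.

Lemma prime_total_preorder S :
  prime_theory P S -> total_preorder (fun A B => S (A ==> B)).
Proof.
move=> pS; split=> A B; last exact: prime_total pS.
by have [thS _ _] := pS; move=> C; apply: imp_trans thS.
Qed.

Section Extension.
Context le v (S S' : set (modal_form V)).
Hypotheses (vo : value_order le) (pS : prime_theory P S).
Hypothesis leS : forall A B, le (v, A) (v, B) <-> S (A ==> B).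
Hypotheses (pS' : prime_theory P S') (boxS : forall A, S (Box A) -> S' A).
Hypothesis diaS : forall A, S' A -> S (Dia A).

(** The two mixed conditions rest on the Fischer Servi axioms. If [B ==> C] is in [S'], then
    [ax_FS1] gives [Box B <= Dia C] at [v]; conversely, [Dia C <= Box B] at [v] puts [C ==> B] into
    [S'] by [ax_FS2]. *)
Lemma forced_compatible :
  compatible le (fun A B => S' (A ==> B)) (forced_up le S' v)
    (forced_down le S' v).
Proof.
have [[tr tot] _ _ _] := vo.
have [thS _ _] := pS; have [thS' _ _] := pS'.
split.
- by move=> a b x ab [B bB Bx]; exists B => //; apply: tr bB.
- by move=> a x y [B aB Bx] xy; exists B => //; apply: (imp_trans thS' Bx xy).
- by move=> x y a xy [B yB Ba]; exists B => //; apply: (imp_trans thS' xy yB).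
- by move=> x a b [B xB Ba] ab; exists B => //; apply: tr ab.
- move=> a x b [B aB Bx] [C xC Cb]; apply: tr aB (tr _ _ _ _ Cb); apply/leS.
  apply: (theory_mp thS (theory_ax thS (ax_FS1 B C))); apply: diaS.
  exact: imp_trans thS' Bx xC.
- move=> x a y [C xC Ca] [B aB By].
  apply: (imp_trans thS' xC); apply: (imp_trans thS' _ By); apply: boxS.
  apply: (theory_mp thS (theory_ax thS (ax_FS2 C B))); apply/leS.
  exact: tr aB.
Qed.

Lemma extend_value_order k U D : (v <= k)%N ->
  compatible le (fun A B => S' (A ==> B)) U D ->
  (forall s A, U s A \/ D A s) ->
  (forall s A, forced_up le S' v s A -> U s A) ->
  (forall s A, forced_down le S' v A s -> D A s) ->
  let le' := extend k le S' U D in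
  [/\ value_order le', agree_upto k le le' & successor le' v k.+1].
Proof.
move=> vk cUD tUD subU subD le'.
have [pre bot top pr] := vo; have [tr tot] := pre.
have [thS nbS _] := pS; have [thS' _ _] := pS'.
have preS' := prime_total_preorder pS'.
have [gtr gtot] := glue_total_preorder pre preS' cUD tUD.
have boxtop : S (Box Top) by apply: (box_thm thS) => T; apply: theory_top.
split.
- split.
  + by split=> [x y z|x y]; [apply: gtr | apply: gtot].
  (* An old [Bot] lies below the new points because it lies below [Box Bot] at [v]; the new [Bot]
     lies below the old points because [Dia Bot] is bottom at [v]. *)
  + move=> n s; rewrite /le' /extend /locate /=.
    case: leqP => _; case: leqP => _ //=; last 1 first.
    * exact: theory_ax thS' (ax_bot _).
    * apply: subU; exists Bot; first exact: bot.
      exact: theory_ax thS' (ax_bot _).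
    * apply: subD; exists Bot; first exact: imp_refl thS'.
      apply: tr (bot v s); apply/leS.
      exact: theory_ax thS (ax_dia_bot _).
  + move=> n s; rewrite /le' /extend /locate /=.
    case: leqP => _; case: leqP => _ //=; last 1 first.
    * exact: imp_top thS'.
    * apply: subU; exists Top; last exact: imp_refl thS'.
      apply: tr (top v s) _; apply/leS; exact: imp_const thS boxtop.
    * apply: subD; exists Top; first exact: imp_top thS'.
      exact: top.
  + move=> n; rewrite /le' /extend /locate /=.
    by case: leqP => _ //=; exists S'.
- by move=> s t sk tk; rewrite /le' /extend /locate sk tk.
move=> A; rewrite /le' /extend /locate /= vk ltnn /=; split.
  apply: subU; exists A; last exact: imp_refl thS'.
  exact: total_preorder_refl.
apply: subD; exists A; first exact: imp_refl thS'.
exact: total_preorder_refl.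
Qed.

End Extension.

(** The new world is placed low, so [s <= A] there would have to be forced by some [B] with
    [s <= Box B] at [v] and [B ==> A] in [S']. By the choice of [S'] this entails [Box B <= Box A],
    hence [s <= Box A]. *)
Lemma box_step le k v A s : value_order le -> (v <= k)%N -> (s.1 <= k)%N ->
  ~ le s (v, Box A) ->
  exists le', [/\ value_order le', agree_upto k le le',
    successor le' v k.+1 & ~ le' s (k.+1, A)].
Proof.
move=> vo vk sk ns; have [pre bot top pr] := vo; have [tr tot] := pre.
have [S [pS leS]] := pr v; have [thS _ _] := pS.
have nA : ~ S (Box A).
  move=> SA; apply: ns; apply: tr (top v s) _; apply/leS; exact: imp_const thS SA.
have [S' [pS' boxS diaS impS]] := box_successor pS nA.
have cp := forced_compatible vo pS leS pS' boxS diaS.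
have cp' := compatible_low pre (prime_total_preorder pS') cp.
have [| | |vo' agr suc] := extend_value_order vo pS leS pS' vk cp'.
- by move=> t B; have [?|?] := pselect (forced_up le S' v t B); [left|right; left].
- by [].
- by right.
eexists; split; [exact: vo'|by []|by []|].
rewrite /extend /locate sk ltnn /= => -[B sB S'BA]; apply: ns.
by apply: tr sB _; apply/leS; apply: impS.
Qed.

(** Mirror image of [box_step], with the new world placed high. *)
Lemma dia_step le k v A s : value_order le -> (v <= k)%N -> (s.1 <= k)%N ->
  ~ le (v, Dia A) s ->
  exists le', [/\ value_order le', agree_upto k le le',
    successor le' v k.+1 & ~ le' (k.+1, A) s].
Proof.
move=> vo vk sk ns; have [pre bot top pr] := vo; have [tr tot] := pre.
have [S [pS leS]] := pr v; have [thS _ _] := pS.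
have nA : ~ S (Dia A ==> Dia Bot).
  move=> SA; apply: ns; apply: tr (bot v s); apply/leS.
  exact: imp_trans thS SA (theory_ax thS (ax_dia_bot _)).
have [S' [pS' boxS diaS impS]] := dia_successor pS nA.
have cp := forced_compatible vo pS leS pS' boxS diaS.
have cp' := compatible_high pre (prime_total_preorder pS') cp.
have [| | |vo' agr suc] := extend_value_order vo pS leS pS' vk cp'.
- by move=> t B; have [?|?] := pselect (forced_down le S' v B t); [right|left; left].
- by right.
- by [].
eexists; split; [exact: vo'|by []|by []|].
rewrite /extend /locate sk ltnn /= => -[B S'AB Bs]; apply: ns.
by apply: tr Bs; apply/leS; apply: impS.
Qed.

End Stages.

(** * Saturated value orders *)

(** Generic trees transfer countability from variables to formulas. Both the enumeration of tasks
    and the embedding into the reals depend on it. *)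
Fixpoint tree_of_form (V : Type) (A : modal_form V) : GenTree.tree V :=
  match A with
  | Var p => GenTree.Leaf p
  | Bot => GenTree.Node 0 [::]
  | And B C => GenTree.Node 1 [:: tree_of_form B; tree_of_form C]
  | Or B C => GenTree.Node 2 [:: tree_of_form B; tree_of_form C]
  | Imp B C => GenTree.Node 3 [:: tree_of_form B; tree_of_form C]
  | Box B => GenTree.Node 4 [:: tree_of_form B]
  | Dia B => GenTree.Node 5 [:: tree_of_form B]
  end.

Fixpoint form_of_tree (V : Type) (t : GenTree.tree V) : modal_form V :=
  match t with
  | GenTree.Leaf p => Var p
  | GenTree.Node 1 [:: t1; t2] => And (form_of_tree t1) (form_of_tree t2)
  | GenTree.Node 2 [:: t1; t2] => Or (form_of_tree t1) (form_of_tree t2)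
  | GenTree.Node 3 [:: t1; t2] => Imp (form_of_tree t1) (form_of_tree t2)
  | GenTree.Node 4 [:: t1] => Box (form_of_tree t1)
  | GenTree.Node 5 [:: t1] => Dia (form_of_tree t1)
  | _ => Bot
  end.

Lemma tree_of_formK (V : Type) : cancel (@tree_of_form V) (@form_of_tree V).
Proof. by elim=> //= [B -> C ->|B -> C ->|B -> C ->|B ->|B ->]. Qed.

HB.instance Definition _ (V : countType) :=
  Countable.copy (modal_form V) (can_type (@tree_of_formK V)).

Section Limit.
Local Open Scope classical_set_scope.
Local Open Scope modal_scope.
Context {V : countType} (P : set extension).
Implicit Types (A B C : modal_form V) (n m k v w : nat).
Local Notation point := (nat * modal_form V)%type.
Implicit Types (le : point -> point -> Prop) (s t : point).

Lemma agree_upto_trans j k le1 le2 le3 : (j <= k)%N ->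
  agree_upto j le1 le2 -> agree_upto k le2 le3 -> agree_upto j le1 le3.
Proof.
move=> jk a12 a23 s t sj tj.
by rewrite a23 ?a12 //; [exact: leq_trans jk|exact: leq_trans jk].
Qed.

(** Here [le] and [le'] are the orders before and after stage [k], and the witness is the world
    [k.+1] created at that stage. *)
Definition box_task le le' k v A s :=
  ~ le s (v, Box A) -> successor le' v k.+1 /\ ~ le' s (k.+1, A).

Definition dia_task le le' k v A s :=
  ~ le (v, Dia A) s -> successor le' v k.+1 /\ ~ le' (k.+1, A) s.

(* Coding tasks by [CodeSeq.code] makes the worlds occurring in a task smaller
   than its code, hence present at the stage where the task is dealt with. *)
Definition task_code (b : bool) v A s :=
  CodeSeq.code [:: v; s.1; pickle (b, A, s.2)].

Lemma task_code_inj b v A s b' v' A' s' :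
  task_code b v A s = task_code b' v' A' s' ->
  [/\ b = b', v = v', A = A' & s = s'].
Proof.
move/(can_inj CodeSeq.codeK) => [-> es /(pcan_inj pickleK)[-> -> es']].
by case: s s' es es' => [? ?] [? ?] /= -> ->.
Qed.

Lemma task_code_bound b v A s :
  (v <= task_code b v A s)%N /\ (s.1 <= task_code b v A s)%N.
Proof.
have /and4P[h1 h2 _ _] := CodeSeq.ltn_code [:: v; s.1; pickle (b, A, s.2)].
by split; apply: ltnW.
Qed.

Lemma stage k le : value_order P le ->
  exists le', [/\ value_order P le', agree_upto k le le',
    forall v A s, k = task_code true v A s -> box_task le le' k v A s &
    forall v A s, k = task_code false v A s -> dia_task le le' k v A s].
Proof.
move=> vo.
have [[[[[b v] A] s] [ek active]]|idle] := pselect (exists x : bool * nat * modal_form V * point,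
    let: (b, v, A, s) := x in k = task_code b v A s /\
    if b then ~ le s (v, Box A) else ~ le (v, Dia A) s).
  have [vk sk] := task_code_bound b v A s; rewrite -ek in vk sk.
  case: b ek active => ek active.
    have [le' [vo' agr suc wit]] := box_step vo vk sk active.
    by exists le'; split=> // v' A' s'; rewrite {1}ek => /task_code_inj[] // _ <- <- <-.
  have [le' [vo' agr suc wit]] := dia_step vo vk sk active.
  by exists le'; split=> // v' A' s'; rewrite {1}ek => /task_code_inj[] // _ <- <- <-.
exists le; split=> // v A s ek act; case: idle.
  by exists (true, v, A, s).
by exists (false, v, A, s).
Qed.

Lemma saturated_value_order le0 : value_order P le0 -> exists le,
  [/\ value_order P le, agree_upto 0 le0 le,
    forall v A s, ~ le s (v, Box A) ->
      exists2 w, successor le v w & ~ le s (w, A) &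
    forall v A s, ~ le (v, Dia A) s ->
      exists2 w, successor le v w & ~ le (w, A) s].
Proof.
move=> vo0.
pose step (x : nat * {le | value_order P le}) (y : {le | value_order P le}) :=
  [/\ agree_upto x.1 (sval x.2) (sval y),
    forall v A s, x.1 = task_code true v A s ->
      box_task (sval x.2) (sval y) x.1 v A s &
    forall v A s, x.1 = task_code false v A s ->
      dia_task (sval x.2) (sval y) x.1 v A s].
have /choice[f fP] : forall x, exists y, step x y.
  move=> [k [le vo]]; have [le' [vo' ? ? ?]] := stage k vo.
  by exists (exist _ le' vo').
pose L := nat_rect (fun _ => {le | value_order P le}) (exist _ le0 vo0)
  (fun k x => f (k, x)).
have agrL j d : agree_upto j (sval (L j)) (sval (L (j + d)%N)).
  elim: d => [|d IH]; first by rewrite addn0.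
  rewrite addnS; apply: (agree_upto_trans (k := (j + d)%N)) IH _; first exact: leq_addr.
  by have [] := fP ((j + d)%N, L (j + d)%N).
(* Comparisons between worlds up to [k] are frozen from stage [k] on, so the limit may be read at
   any stage at least as large as both worlds. *)
pose le s t := sval (L (maxn s.1 t.1)) s t.
have leE k s t : (s.1 <= k)%N -> (t.1 <= k)%N -> le s t <-> sval (L k) s t.
  move=> sk tk; have mk : (maxn s.1 t.1 <= k)%N by rewrite geq_max sk.
  by rewrite -(subnKC mk) agrL ?leq_maxl ?leq_maxr.
have sucE v w k : (v <= k)%N -> (w <= k)%N -> successor (sval (L k)) v w -> successor le v w.
  by move=> vk wk h A; rewrite !(leE k) //; apply: h.
have voL k := svalP (L k).
exists le; split.
- split.
  + split=> [x y z|x y].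
      pose k := maxn x.1 (maxn y.1 z.1).
      have [xk yk zk] : [/\ x.1 <= k, y.1 <= k & z.1 <= k]%N.
        by rewrite /k !leq_max !leqnn !orbT.
      by rewrite !(leE k) //; apply: (vo_pre (voL k)).1.
    pose k := maxn x.1 y.1.
    rewrite !(leE k) ?leq_maxl ?leq_maxr //.
    exact: (vo_pre (voL k)).2.
  + by move=> n s; apply: vo_bot (voL _) _ _.
  + by move=> n s; apply: vo_top (voL _) _ _.
  + move=> n; have [S [pS hS]] := vo_prime (voL n) n.
    by exists S; split=> // A B; rewrite (leE n).
- by move=> s t s0 t0; rewrite (leE 0%N).
(* The code bounds both worlds of the task, so [ns] already holds at stage [k], where the task is
   handled. *)
- move=> v A s ns; pose k := task_code true v A s.
  have [vk sk] := task_code_bound true v A s.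
  have [_ h _] := fP (k, L k).
  have [|suc ns'] := h v A s erefl; first by rewrite -leE.
  exists k.+1; first by apply: (sucE _ _ k.+1) suc => //; apply: leqW.
  by rewrite (leE k.+1) //; apply: leqW.
- move=> v A s ns; pose k := task_code false v A s.
  have [vk sk] := task_code_bound false v A s.
  have [_ _ h] := fP (k, L k).
  have [|suc ns'] := h v A s erefl; first by rewrite -leE.
  exists k.+1; first by apply: (sucE _ _ k.+1) suc => //; apply: leqW.
  by rewrite (leE k.+1) //; apply: leqW.
Qed.

Lemma countermodel_order (Gamma : set (modal_form V)) A :
  ~ derives P Gamma A -> exists le, [/\ value_order P le,
    forall B, Gamma B -> le (0%N, Top) (0%N, B), ~ le (0%N, Top) (0%N, A),
    forall v B s, ~ le s (v, Box B) ->
      exists2 w, successor le v w & ~ le s (w, B) &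
    forall v B s, ~ le (v, Dia B) s ->
      exists2 w, successor le v w & ~ le (w, B) s].
Proof.
move=> nA.
have [||||S [pS subS nS]] := @lindenbaum _ P (derives P Gamma) [set A].
- exact: derives_theory.
- by exists A.
- move=> _ _ -> ->; exists A => // T thT.
  by apply: (or_elim thT); apply: imp_refl thT.
- by move=> _ ->.
have [thS _ _] := pS; have [trS totS] := prime_total_preorder pS.
(* Initially every world is a copy of [S]; agreement up to [0] preserves this theory at world [0] in
   the limit. *)
have [|le [vo agr box dia]] := @saturated_value_order (fun s t => S (s.2 ==> t.2)).
  split=> [|n s|n s|n]; last by exists S.
  - by split=> [x y z|x y]; [apply: trS | apply: totS].
  - exact: theory_ax thS (ax_bot _).
  - exact: imp_top thS.
exists le; split=> //.
  move=> B GB; rewrite agr //=; apply: (imp_const _ thS).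
  by apply: subS; apply: der_prem.
by rewrite agr //= (top_imp _ thS); apply: (nS A).
Qed.

End Limit.

(** * Soundness *)

Section UnitInterval.
Local Open Scope classical_set_scope.
Context {R : realType}.
Implicit Types (S : set R) (a b c : R).

Lemma inf01_lb S a : (forall b, S b -> 0 <= b) -> S a -> inf01 S <= a.
Proof.
move=> S0 Sa; rewrite /inf01; case: eqP => [S_eq0|_].
  by rewrite S_eq0 in Sa.
by apply: ge_inf => //; exists 0.
Qed.

Lemma le_inf01 S c : c <= 1 -> (forall a, S a -> c <= a) -> c <= inf01 S.
Proof.
move=> c1 cS; rewrite /inf01; case: eqP => // /eqP/set0P S0.
exact: lb_le_inf.
Qed.

Lemma inf01_le1 S : (forall b, S b -> 0 <= b <= 1) -> inf01 S <= 1.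
Proof.
move=> SI; rewrite /inf01; case: eqP => // /eqP/set0P[a Sa].
have /andP[_ a1] := SI _ Sa; apply: le_trans a1.
by apply: ge_inf => //; exists 0 => b /SI/andP[].
Qed.

Lemma sup01_ub S a : (forall b, S b -> b <= 1) -> S a -> a <= sup01 S.
Proof.
move=> S1 Sa; rewrite /sup01; case: eqP => [S_eq0|_].
  by rewrite S_eq0 in Sa.
by apply: ub_le_sup => //; exists 1.
Qed.

Lemma sup01_le S c : 0 <= c -> (forall a, S a -> a <= c) -> sup01 S <= c.
Proof.
move=> c0 Sc; rewrite /sup01; case: eqP => // /eqP/set0P S0.
exact: ge_sup.
Qed.

Lemma sup01_ge0 S : (forall b, S b -> 0 <= b <= 1) -> 0 <= sup01 S.
Proof.
move=> SI; rewrite /sup01; case: eqP => // /eqP/set0P[a Sa].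
have /andP[a0 _] := SI _ Sa; apply: le_trans a0 _.
by apply: ub_le_sup => //; exists 1 => b /SI/andP[].
Qed.

Lemma godel_imp_eq1 a b : a <= 1 -> godel_imp a b = 1 <-> a <= b.
Proof.
by move=> a1; rewrite /godel_imp; case: leP => // ba; split=> // b1; lra.
Qed.

Lemma le_godel_imp a b c :
  c <= 1 -> c <= godel_imp a b <-> Num.min c a <= b.
Proof.
move=> c1; rewrite /godel_imp ge_min; case: ifP => [_|_]; last by rewrite orbF.
by rewrite orbT c1.
Qed.

End UnitInterval.

Section Soundness.
Local Open Scope classical_set_scope.
Local Open Scope modal_scope.
Context {R : realType} {V : Type}.
Implicit Types (M : crisp_model R V) (A B C : modal_form V) (c : R).

Lemma geval_itv M (v : M) A : 0 <= geval v A <= 1.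
Proof.
elim: A v => /= [p|| A IHA B IHB|A IHA B IHB|A IHA B IHB|A IHA|A IHA] v.
- exact: valuation_itv.
- by rewrite lexx ler01.
- have /andP[a0 a1] := IHA v; have /andP[b0 b1] := IHB v.
  by rewrite le_min ge_min a0 b0 a1.
- have /andP[a0 a1] := IHA v; have /andP[b0 b1] := IHB v.
  by rewrite le_max ge_max a0 a1 b1.
- by rewrite /godel_imp; case: ifP => // _; rewrite ler01 lexx.
- apply/andP; split.
    by apply: le_inf01 => // _ [w _ <-]; have /andP[] := IHA w.
  by apply: inf01_le1 => _ [w _ <-].
- apply/andP; split.
    by apply: sup01_ge0 => _ [w _ <-].
  by apply: sup01_le => // _ [w _ <-]; have /andP[] := IHA w.
Qed.

Lemma geval_ge0 M (v : M) A : 0 <= geval v A.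
Proof. by have /andP[] := geval_itv v A. Qed.

Lemma geval_le1 M (v : M) A : geval v A <= 1.
Proof. by have /andP[] := geval_itv v A. Qed.

Lemma geval_box_le M (v w : M) A :
  access M v w -> geval v (Box A) <= geval w A.
Proof.
move=> vw; apply: inf01_lb; last by exists w.
by move=> _ [u _ <-]; apply: geval_ge0.
Qed.

Lemma le_geval_box M (v : M) A c : c <= 1 ->
  (forall w, access M v w -> c <= geval w A) -> c <= geval v (Box A).
Proof. by move=> c1 h; apply: le_inf01 => // _ [w vw <-]; apply: h. Qed.

Lemma le_geval_dia M (v w : M) A :
  access M v w -> geval w A <= geval v (Dia A).
Proof.
move=> vw; apply: sup01_ub; last by exists w.
by move=> _ [u _ <-]; apply: geval_le1.
Qed.

Lemma geval_dia_le M (v : M) A c : 0 <= c ->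
  (forall w, access M v w -> geval w A <= c) -> geval v (Dia A) <= c.
Proof. by move=> c0 h; apply: sup01_le => // _ [w vw <-]; apply: h. Qed.

Lemma geval_imp_eq1 M (v : M) A B :
  geval v (A ==> B) = 1 <-> geval v A <= geval v B.
Proof. by apply: godel_imp_eq1; apply: geval_le1. Qed.

Lemma le_geval_imp M (v : M) A B c :
  c <= 1 -> c <= geval v (A ==> B) <-> Num.min c (geval v A) <= geval v B.
Proof. exact: le_godel_imp. Qed.

Lemma geval_mp M (v : M) A B :
  Num.min (geval v (A ==> B)) (geval v A) <= geval v B.
Proof. by apply/le_geval_imp => //; apply: geval_le1. Qed.

(* Innermost comparisons first, so that no conditional ends up in a hypothesis. *)
Local Ltac decide_le :=
  match goal with
  | |- context [(?x <= ?y)%R] =>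
    lazymatch constr:((x, y)) with
    | context [if _ then _ else _] => fail
    | _ => case: (leP x y) => ?
    end
  end.

Lemma gkc_axiom_sound M (v : M) A : gkc_axiom A -> geval v A = 1.
Proof.
have I B : 0 <= geval v B <= 1 := geval_itv v B.
case=> {A} [A B|A B C|A B|A B|A B|A B|A B|A B C|A|A B|A B|A B|A B|A B||A B].
1-10: have /andP[A0 A1] := I A; try have /andP[B0 B1] := I B;
  try have /andP[C0 C1] := I C;
  rewrite /= /godel_imp ?minEle ?maxEle; repeat decide_le; lra.
- apply/geval_imp_eq1/le_geval_imp; first exact: geval_le1.
  apply: le_geval_box => [|w vw]; first by rewrite ge_min geval_le1.
  apply: le_trans (geval_mp w A B).
  by rewrite le_min !ge_min !geval_box_le // orbT.
- apply/geval_imp_eq1; apply: geval_dia_le => [|w vw]; first exact: geval_ge0.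
  change (Num.max (geval w A) (geval w B) <= Num.max (geval v (Dia A)) (geval v (Dia B)))%R.
  by rewrite ge_max !le_max !le_geval_dia ?orbT.
- apply/geval_imp_eq1; apply: geval_dia_le => [|w vw]; first exact: geval_ge0.
  apply/le_geval_imp; first exact: geval_le1.
  apply: le_trans (le_geval_dia B vw); apply: le_trans (geval_mp w A B).
  by rewrite le_min !ge_min lexx geval_box_le // orbT.
- apply/geval_imp_eq1; apply: le_geval_box => [|w vw]; first exact: geval_le1.
  apply/le_geval_imp; first exact: geval_le1.
  apply: le_trans (geval_box_le B vw); apply: le_trans (geval_mp v (Dia A) (Box B)).
  by rewrite le_min !ge_min lexx le_geval_dia // orbT.
- by apply/geval_imp_eq1; apply: geval_dia_le.
- apply/geval_imp_eq1; change (geval v (Box (A || B)) <= Num.max (geval v (Box A)) (geval v (Dia B)))%R.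
  (* If [Dia B] is strictly below [Box (A || B)], then [B] is too small at every successor, and [A]
     alone must reach the value of [Box (A || B)] there. *)
  rewrite le_max; case: (leP (geval v (Box (A || B))) (geval v (Dia B))) => [|ltB].
    by rewrite orbT.
  rewrite orbF; apply: le_geval_box => [|w vw]; first exact: geval_le1.
  have := geval_box_le (A || B) vw; rewrite /= le_max => /orP[//|h].
  by have := lt_le_trans ltB (le_trans h (le_geval_dia B vw)); rewrite ltxx.
Qed.

Lemma ext_axiom_sound M (v : M) x A :
  frame_condition x (access M) -> ext_axiom x A -> geval v A = 1.
Proof.
move=> + ax; case: ax => {x A} [A|A|A|A|A|A|A|A|] fc;
  rewrite /frame_condition in fc; try apply/geval_imp_eq1.
- by apply: geval_box_le; apply: fc.
- by apply: le_geval_dia; apply: fc.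
- apply: le_geval_box => [|w vw]; first exact: geval_le1.
  apply: le_geval_box => [|u wu]; first exact: geval_le1.
  exact: geval_box_le (fc _ _ _ vw wu).
- apply: geval_dia_le => [|w vw]; first exact: geval_ge0.
  apply: geval_dia_le => [|u wu]; first exact: geval_ge0.
  exact: le_geval_dia (fc _ _ _ vw wu).
- apply: le_geval_box => [|w vw]; first exact: geval_le1.
  exact: le_geval_dia (fc _ _ vw).
- apply: geval_dia_le => [|w vw]; first exact: geval_ge0.
  exact: geval_box_le (fc _ _ vw).
- apply: le_geval_box => [|w vw]; first exact: geval_le1.
  apply: geval_dia_le => [|u vu]; first exact: geval_ge0.
  exact: le_geval_dia (fc _ _ _ vw vu).
- apply: geval_dia_le => [|w vw]; first exact: geval_ge0.
  apply: le_geval_box => [|u vu]; first exact: geval_le1.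
  exact: geval_box_le (fc _ _ _ vw vu).
have [w vw] := fc v; apply/eqP; rewrite eq_le geval_le1 /=.
have -> : 1 = geval w Top by rewrite /= /godel_imp lexx.
exact: le_geval_dia.
Qed.

Theorem soundness (P : set extension) (Gamma : set (modal_form V)) A :
  derives P Gamma A -> forall M, (forall x, P x -> frame_condition x (access M)) ->
  forall v : M, (forall B, Gamma B -> geval v B = 1) -> geval v A = 1.
Proof.
move=> d M fr; elim: d => {Gamma A} => [Gamma A GA|Gamma A ax|
  Gamma x A Px ax|Gamma A B _ IHAB _ IHA|Gamma A _ IH|Gamma A B _ IH] v Gv.
- exact: Gv.
- exact: gkc_axiom_sound.
- exact: ext_axiom_sound (fr _ Px) ax.
- have /geval_imp_eq1 := IHAB v Gv; rewrite IHA // => h.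
  by apply/eqP; rewrite eq_le geval_le1.
- apply/eqP; rewrite eq_le geval_le1 /=; apply: le_geval_box => // w _.
  by rewrite IH.
- apply/geval_imp_eq1; apply: geval_dia_le => [|w vw]; first exact: geval_ge0.
  apply: le_trans (le_geval_dia _ vw); apply/geval_imp_eq1.
  by apply: IH => ? [].
Qed.

End Soundness.

(** * Embedding a countable linear preorder into the unit interval *)

Section Embedding.
Local Open Scope classical_set_scope.
Context {R : realType} {X : countType} (le : X -> X -> Prop).
Context (bot top : X).
Hypotheses (pre : total_preorder le).
Hypotheses (le_bot : forall x, le bot x) (le_top : forall x, le x top).
Hypothesis nontrivial : ~ le top bot.
Implicit Types (x y z : X) (n : nat).

Local Notation lt x y := (~ le y x).

Lemma preorder_trans x y z : le x y -> le y z -> le x z.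
Proof. exact: pre.1. Qed.

Lemma preorder_refl x : le x x.
Proof. exact: total_preorder_refl. Qed.

Local Hint Resolve preorder_refl : core.

Lemma lt_leW x y : lt x y -> le x y.
Proof. by case: (pre.2 x y). Qed.

Lemma le_lt x y z : le x y -> lt y z -> lt x z.
Proof. by move=> xy yz zx; apply: yz; apply: preorder_trans xy. Qed.

Lemma lt_le x y z : lt x y -> le y z -> lt x z.
Proof. by move=> xy yz zx; apply: xy; apply: preorder_trans zx. Qed.

Lemma trichotomy x y : [\/ lt x y, lt y x | le x y /\ le y x].
Proof.
have [xy|nxy] := pselect (le x y); last by constructor 2.
have [yx|nyx] := pselect (le y x); last by constructor 1.
by constructor 3.
Qed.

(** * Bisection of cells by the enumerated points *)

Record cell := Cell { lo : X; hi : X; vlo : R; vhi : R }.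

(** An open cell is a gap between two inserted points, with the values these received. A cell that
    is not open has collapsed to the class of one inserted point. *)
Definition open c := lt (lo c) (hi c).

Definition mid c : R := (vlo c + vhi c) / 2.

(* Insert the point [x] and return the part of [c] to which [z] belongs. *)
Definition subcell x z c : cell :=
  if `[< lt (lo c) x /\ lt x (hi c) >] then
    Cell (if `[< le x z >] then x else lo c) (if `[< le z x >] then x else hi c)
      (if `[< le x z >] then mid c else vlo c)
      (if `[< le z x >] then mid c else vhi c)
  else c.

Lemma subcell_out x z c : ~ (lt (lo c) x /\ lt x (hi c)) -> subcell x z c = c.
Proof. by rewrite /subcell; case: asboolP. Qed.

Lemma subcell_lt x z c : lt (lo c) x -> lt x (hi c) -> lt z x ->
  subcell x z c = Cell (lo c) x (vlo c) (mid c).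
Proof.
move=> lx xh zx; rewrite /subcell asboolT // asboolF // asboolT //; exact: lt_leW.
Qed.

Lemma subcell_gt x z c : lt (lo c) x -> lt x (hi c) -> lt x z ->
  subcell x z c = Cell x (hi c) (mid c) (vhi c).
Proof.
move=> lx xh xz; rewrite /subcell asboolT // (asboolT (lt_leW xz)) asboolF //.
Qed.

Lemma subcell_eq x z c : lt (lo c) x -> lt x (hi c) -> le x z -> le z x ->
  subcell x z c = Cell x x (mid c) (mid c).
Proof. by move=> lx xh xz zx; rewrite /subcell !asboolT. Qed.

Lemma subcell_closed x z c : ~ open c -> subcell x z c = c.
Proof.
by move=> nc; apply: subcell_out => -[lx xh]; apply: nc; apply: lt_le lx (lt_leW xh).
Qed.

Definition start z : cell :=
  if `[< le z bot >] then Cell bot bot 0 0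
  else if `[< le top z >] then Cell top top 1 1 else Cell bot top 0 1.

(** The default is harmless: nothing lies strictly below [bot], so inserting it changes no cell. *)
Definition enum_point n : X := odflt bot (unpickle n).

Fixpoint cell_at n z : cell :=
  if n is n'.+1 then subcell (enum_point n') z (cell_at n' z) else start z.

Lemma enum_point_pickle z : enum_point (pickle z) = z.
Proof. by rewrite /enum_point pickleK. Qed.

Record inside z c : Prop := Inside {
  inside_lo : le (lo c) z;
  inside_hi : le z (hi c);
  inside_open : open c -> [/\ vlo c < vhi c, lt (lo c) z & lt z (hi c)];
  inside_closed : ~ open c -> vlo c = vhi c }.

Lemma inside_subcell x z c : inside z c -> inside z (subcell x z c).
Proof.
move=> [lz zh iop icl].
have [[lx xh]|out] := pselect (lt (lo c) x /\ lt x (hi c)); last first.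
  by rewrite subcell_out.
have [v1 v2 v3] := iop (lt_le lx (lt_leW xh)).
have [zx|xz|[zx xz]] := trichotomy z x.
- rewrite subcell_lt //; split => //=; first exact: lt_leW.
  by split=> //=; rewrite /mid; lra.
- rewrite subcell_gt //; split => //=; first exact: lt_leW.
  by split=> //=; rewrite /mid; lra.
- by rewrite subcell_eq //; split => //= h; case: (h (preorder_refl x)).
Qed.

Lemma inside_cell_at n z : inside z (cell_at n z).
Proof.
elim: n => [|n IH] /=; last exact: inside_subcell.
rewrite /start; case: asboolP => [zb|bz]; first by split => //= /(_ (preorder_refl _)).
case: asboolP => [tz|zt]; first by split => //= /(_ (preorder_refl _)).
by split=> //= _; split.
Qed.

(** A cell collapses only onto its midpoint, which is strictly between its end values; the last
    clause records this, and strict monotonicity of the embedding comes from it. *)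
Lemma subcell_shrink x z c (c' := subcell x z c) : inside z c ->
  [/\ le (lo c) (lo c'), le (hi c') (hi c), vlo c <= vlo c', vhi c' <= vhi c &
    open c -> ~ open c' -> vlo c < vlo c' /\ vhi c' < vhi c].
Proof.
move=> [lz zh iop icl]; rewrite /c'.
have [[lx xh]|out] := pselect (lt (lo c) x /\ lt x (hi c)); last first.
  by rewrite subcell_out.
have [v1 v2 v3] := iop (lt_le lx (lt_leW xh)).
have m1 : vlo c < mid c by rewrite /mid; lra.
have m2 : mid c < vhi c by rewrite /mid; lra.
have [zx|xz|[zx xz]] := trichotomy z x.
- by rewrite subcell_lt //; split => //=; [exact: lt_leW|exact: ltW].
- by rewrite subcell_gt //; split => //=; [exact: lt_leW|exact: ltW].
- rewrite subcell_eq //; split => //=; try exact: lt_leW; exact: ltW.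
Qed.

Lemma closed_stable n m z :
  (n <= m)%N -> ~ open (cell_at n z) -> cell_at m z = cell_at n z.
Proof.
move=> /subnKC <- cl; elim: (m - n)%N => [|d IH]; first by rewrite addn0.
by rewrite addnS /= IH subcell_closed.
Qed.

(** The point with code [n] is inserted in passing from stage [n] to stage [n.+1], so at
    [(pickle z).+1] the point [z] itself has been inserted. *)
Lemma cell_at_closed z : ~ open (cell_at (pickle z).+1 z).
Proof.
rewrite /= enum_point_pickle.
have [op|cl] := pselect (open (cell_at (pickle z) z)); last by rewrite subcell_closed.
have [_ _ /(_ op)[_ lz zh] _] := inside_cell_at (pickle z) z.
by rewrite subcell_eq //= /open /= => /(_ (preorder_refl z)).
Qed.

(** * The embedding and its strict monotonicity *)

Definition embed z : R := vlo (cell_at (pickle z).+1 z).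

Lemma embed_closed n z : ~ open (cell_at n z) -> embed z = vlo (cell_at n z).
Proof.
move=> cl; have [h|h] := leqP n (pickle z).+1.
  by rewrite /embed (closed_stable h).
by rewrite (closed_stable (ltnW h)) //; apply: cell_at_closed.
Qed.

Lemma cell_at_shrink n m z : (n <= m)%N ->
  vlo (cell_at n z) <= vlo (cell_at m z) /\ vhi (cell_at m z) <= vhi (cell_at n z).
Proof.
move=> /subnKC <-; elim: (m - n)%N => [|d [IH1 IH2]]; first by rewrite addn0.
rewrite addnS /=; have [_ _ h1 h2 _] := subcell_shrink (enum_point (n + d)) (inside_cell_at (n + d) z).
by split; [exact: Order.POrderTheory.le_trans h1|exact: Order.POrderTheory.le_trans IH2].
Qed.

Lemma embed_bounds n z : vlo (cell_at n z) <= embed z <= vhi (cell_at n z).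
Proof.
pose m := maxn n (pickle z).+1.
have [h1 h2] := cell_at_shrink z (leq_maxl n (pickle z).+1).
have cl : ~ open (cell_at m z).
  by rewrite (closed_stable (leq_maxr _ _)); apply: cell_at_closed.
rewrite (embed_closed cl) h1 /=.
by rewrite (inside_closed (inside_cell_at m z) cl).
Qed.

Lemma cell_at_equiv n y z : le y z -> le z y -> cell_at n y = cell_at n z.
Proof.
move=> yz zy.
have e1 x : `[< le x y >] = `[< le x z >].
  by apply: asbool_equiv_eq; split=> h; [exact: preorder_trans yz|exact: preorder_trans zy].
have e2 x : `[< le y x >] = `[< le z x >].
  by apply: asbool_equiv_eq; split; apply: preorder_trans.
by elim: n => [|n /= ->]; rewrite /= ?/start ?/subcell ?e1 ?e2.
Qed.

(** Invariant of the bisection: the two points share an open cell until an inserted point separates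
    them, and afterwards their cells stay in order. Adjacent cells may share an end value while one
    of them is open; once both have collapsed the values differ. *)
Lemma cell_at_separates n y z : lt y z ->
  open (cell_at n y) /\ cell_at n y = cell_at n z \/
  [/\ le (hi (cell_at n y)) (lo (cell_at n z)), vhi (cell_at n y) <= vlo (cell_at n z) &
    ~ open (cell_at n y) -> ~ open (cell_at n z) -> vhi (cell_at n y) < vlo (cell_at n z)].
Proof.
move=> yz; elim: n => [|n [[op IH]|[IH1 IH2 IH3]]] /=.
- rewrite /start.
  case: (asboolP (le y bot)) => [yb|nyb].
    rewrite asboolF; last by move=> zb; apply: yz; apply: preorder_trans zb _.
    right; case: asboolP => [tz|ntz]; split => //=.
  rewrite [`[< le z bot >]]asboolF; last first.
    by move=> zb; apply: yz; apply: preorder_trans zb _.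
  rewrite [`[< le top y >]]asboolF; last first.
    by move=> ty; apply: yz; apply: preorder_trans ty.
  case: asboolP => [tz|ntz]; [right|left]; split=> //=.
- rewrite -IH; set c := cell_at n y in op *; set x := enum_point n.
  have [[lx xh]|out] := pselect (lt (lo c) x /\ lt x (hi c)); last first.
    by rewrite !subcell_out //; left.
  have [yx|xy|[yx xy]] := trichotomy y x.
  + rewrite [subcell x y c]subcell_lt //.
    have [zx|xz|[zx xz]] := trichotomy z x.
    * by left; rewrite subcell_lt.
    * by right; rewrite subcell_gt //; split=> //= /(_ lx).
    * by right; rewrite subcell_eq //; split=> //= /(_ lx).
  + have xz : lt x z by apply: lt_le xy (lt_leW yz).
    by left; rewrite !subcell_gt.
  + have xz : lt x z by apply: le_lt yz.
    by right; rewrite subcell_eq // subcell_gt //; split=> //= _ /(_ xh).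
- have [_ h1 _ h2 h3] := subcell_shrink (enum_point n) (inside_cell_at n y).
  have [k1 _ k2 _ k3] := subcell_shrink (enum_point n) (inside_cell_at n z).
  right; split; first by apply: preorder_trans h1 (preorder_trans IH1 k1).
    exact: Order.POrderTheory.le_trans h2 (Order.POrderTheory.le_trans IH2 k2).
  move=> cy cz.
  have [oy|ny] := pselect (open (cell_at n y)).
    have [_ h] := h3 oy cy.
    exact: lt_le_trans h (Order.POrderTheory.le_trans IH2 k2).
  have [oz|nz] := pselect (open (cell_at n z)).
    have [h _] := k3 oz cz.
    exact: le_lt_trans h2 (le_lt_trans IH2 h).
  by rewrite !subcell_closed //; apply: IH3.
Qed.

Lemma embed_lt y z : lt y z -> embed y < embed z.
Proof.
move=> yz; pose m := maxn (pickle y).+1 (pickle z).+1.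
have cy : ~ open (cell_at m y).
  by rewrite (closed_stable (leq_maxl _ _)); apply: cell_at_closed.
have cz : ~ open (cell_at m z).
  by rewrite (closed_stable (leq_maxr _ _)); apply: cell_at_closed.
rewrite (embed_closed cy) (embed_closed cz).
have [[]//|[_ _ /(_ cy cz)]] := cell_at_separates m yz.
by rewrite -(inside_closed (inside_cell_at m y) cy).
Qed.

Lemma embed_le y z : embed y <= embed z <-> le y z.
Proof.
split=> [h|yz].
  by apply: contrapT => /embed_lt; rewrite ltNge h.
have [zy|/embed_lt/ltW//] := pselect (le z y).
have cz : ~ open (cell_at (pickle y).+1 z).
  by rewrite -(cell_at_equiv _ yz zy); apply: cell_at_closed.
by rewrite (embed_closed cz) /embed (cell_at_equiv _ yz zy).
Qed.

Lemma embed_bot : embed bot = 0.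
Proof.
have e : cell_at 0 bot = Cell bot bot 0 0 by rewrite /= /start asboolT.
by rewrite (@embed_closed 0%N) e // => /(_ (preorder_refl bot)).
Qed.

Lemma embed_top : embed top = 1.
Proof.
have e : cell_at 0 top = Cell top top 1 1 by rewrite /= /start asboolF // asboolT.
by rewrite (@embed_closed 0%N) e // => /(_ (preorder_refl top)).
Qed.

Lemma embed_itv z : 0 <= embed z <= 1.
Proof.
rewrite -embed_bot -embed_top.
by apply/andP; split; apply/embed_le.
Qed.

(** * Preservation of infima and suprema *)

Lemma cell_at_eq n y z : open (cell_at n y) ->
  lt (lo (cell_at n y)) z -> lt z (hi (cell_at n y)) -> cell_at n z = cell_at n y.
Proof.
move=> op lz zh; have [yz|zy|[yz zy]] := trichotomy y z.
- have [[_ //]|[h _ _]] := cell_at_separates n yz.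
  by case: zh; apply: preorder_trans h _; apply: inside_lo; apply: inside_cell_at.
- have [[_ //]|[h _ _]] := cell_at_separates n zy.
  by case: lz; apply: preorder_trans h; apply: inside_hi; apply: inside_cell_at.
- exact: cell_at_equiv.
Qed.

(** Some later point must fall into the cell, since [y] itself closes it at the latest; the
    induction runs on the number of stages left until then. *)
Lemma cell_hit n y : open (cell_at n y) -> exists n',
  [/\ cell_at n' y = cell_at n y, lt (lo (cell_at n y)) (enum_point n') &
    lt (enum_point n') (hi (cell_at n y))].
Proof.
move=> op; have [m le_m] : exists m, ((pickle y).+1 <= n + m)%N.
  by exists (pickle y).+1; apply: leq_addl.
elim: m n op le_m => [|m IH] n op le_m.
  case: (@cell_at_closed y); rewrite -(closed_stable le_m) ?addn0 //.
  exact: cell_at_closed.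
have [[lx xh]|out] := pselect
  (lt (lo (cell_at n y)) (enum_point n) /\ lt (enum_point n) (hi (cell_at n y))).
  by exists n.
have e : cell_at n.+1 y = cell_at n y by rewrite /= subcell_out.
by have := IH n.+1; rewrite e; apply=> //; rewrite addSnnS.
Qed.

(** Both halves are described for all their points, so that halving can be iterated with a new
    representative each time. *)
Lemma cell_halved n y (c := cell_at n y) : open c -> exists n' x,
  [/\ lt (lo c) x, lt x (hi c),
    forall z, lt (lo c) z -> lt z x -> cell_at n' z = Cell (lo c) x (vlo c) (mid c) &
    forall z, lt x z -> lt z (hi c) -> cell_at n' z = Cell x (hi c) (mid c) (vhi c)].
Proof.
move=> op; have [n' [e lx xh]] := cell_hit op.
exists n'.+1, (enum_point n'); rewrite -/c in e lx xh.
split=> // z h1 h2; rewrite /= (@cell_at_eq n' y) e //.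
- exact: subcell_lt.
- by apply: lt_le h2 (lt_leW xh).
- exact: subcell_gt.
- by apply: le_lt (lt_leW lx) h1.
Qed.

Lemma cell_closing z : lt bot z -> lt z top -> exists n,
  [/\ open (cell_at n z), le (enum_point n) z, le z (enum_point n) & embed z = mid (cell_at n z)].
Proof.
move=> bz zt; have op0 : open (cell_at 0 z).
  by rewrite /= /start asboolF // asboolF.
have [m [opm clm]] : exists m, open (cell_at m z) /\ ~ open (cell_at m.+1 z).
  apply: contrapT => nex; case: (@cell_at_closed z).
  elim: (pickle z).+1 => // n IH; apply: contrapT => cl; apply: nex.
  by exists n.
exists m; set x := enum_point m; set c := cell_at m z.
have pE : cell_at m.+1 z = subcell x z c by [].
have [[lx xh]|out] := pselect (lt (lo c) x /\ lt x (hi c)); last first.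
  by case: clm; rewrite pE subcell_out.
have [zx|xz|[zx xz]] := trichotomy z x.
- by case: clm; rewrite pE subcell_lt.
- by case: clm; rewrite pE subcell_gt.
- by split=> //; rewrite (embed_closed clm) pE subcell_eq.
Qed.

Lemma geometric_small (w eps : R) : 0 < eps -> exists k, w / 2 ^+ k < eps.
Proof.
move=> eps0; set k := Num.bound `|w / eps|; exists k.
rewrite ltr_pdivrMr ?exprn_gt0 // mulrC -ltr_pdivrMr //.
apply: le_lt_trans (ler_norm _) _.
apply: lt_trans (archi_boundP (normr_ge0 _)) _.
by rewrite -natrX ltr_nat ltn_expl.
Qed.

(* If [z] has no immediate successor, then the cell just above [z] is never
   empty, so it is bisected infinitely often. *)
Lemma embed_right z (eps : R) : 0 < eps -> lt z top -> exists y, lt z y /\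
  ((forall y', lt z y' -> le y y') \/ embed y < embed z + eps).
Proof.
move=> eps0 zt; apply: contrapT => nex.
have dense y : lt z y -> exists y', lt z y' /\ lt y' y.
  move=> zy; apply: contrapT => ny; apply: nex; exists y; split=> //; left=> y' zy'.
  by apply: contrapT => nyy'; apply: ny; exists y'.
have [w wP] : exists w : R, forall k, exists n y, [/\ open (cell_at n y),
    le (lo (cell_at n y)) z, le z (lo (cell_at n y)), vlo (cell_at n y) = embed z &
    vhi (cell_at n y) = embed z + w / 2 ^+ k].
  suff [n [y [op h1 h2 h3]]] : exists n y, [/\ open (cell_at n y),
      le (lo (cell_at n y)) z, le z (lo (cell_at n y)) & vlo (cell_at n y) = embed z].
    exists (vhi (cell_at n y) - embed z).
    elim=> [|k [n' [y' [op' h1' h2' h3' h4']]]].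
      by exists n, y; split=> //; rewrite expr0 divr1 addrC subrK.
    (* Density yields a point between [z] and the splitting point [x], so the lower half is
       inhabited and keeps [z] as its lower end. *)
    have [m [x [lx xh hl _]]] := cell_halved op'.
    have [y2 [zy2 y2x]] := dense x (le_lt h2' lx).
    exists m, y2; rewrite (hl _ (le_lt h1' zy2) y2x); split=> //=.
    rewrite /mid h3' h4' exprS invfM; lra.
  (* The first such cell is the initial one if [z] is equivalent to [bot], and otherwise the upper
     half of the cell bisected when the class of [z] is inserted. *)
  have [zb|bz] := pselect (le z bot).
    have [y [zy yt]] := dense top zt; exists 0%N, y.
    rewrite /= /start asboolF; last by move=> h; apply: zy; apply: preorder_trans h _.
    rewrite asboolF //; split=> //=.
    by apply/eqP; rewrite -embed_bot eq_le; apply/andP; split; apply/embed_le.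
  have [n [op xz zx ez]] := cell_closing bz zt.
  have [_ _ /(_ op)[_ lz zh] _] := inside_cell_at n z.
  have [y [zy yh]] := dense _ zh; exists n.+1, y.
  have xh := le_lt xz zh; have lx := lt_le lz zx.
  rewrite /= (@cell_at_eq n z) //; last by apply: le_lt (lt_leW lz) zy.
  by rewrite subcell_gt //; apply: le_lt zy.
have [k wk] := geometric_small w eps0.
have [n [y [op h1 h2 h3 h4]]] := wP k.
apply: nex; exists y; split.
  by apply: le_lt h2 _; have [_ _ /(_ op)[]] := inside_cell_at n y.
right; have /andP[_ h] := embed_bounds n y.
by apply: le_lt_trans h _; rewrite h4 ltrD2l.
Qed.

(** Mirror image of [embed_right]: without an immediate predecessor of [z], the cell just below [z]
    is halved forever, keeping the upper half. *)
Lemma embed_left z (eps : R) : 0 < eps -> lt bot z -> exists y, lt y z /\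
  ((forall y', lt y' z -> le y' y) \/ embed z - eps < embed y).
Proof.
move=> eps0 bz; apply: contrapT => nex.
have dense y : lt y z -> exists y', lt y y' /\ lt y' z.
  move=> yz; apply: contrapT => ny; apply: nex; exists y; split=> //; left=> y' y'z.
  by apply: contrapT => nyy'; apply: ny; exists y'.
have [w wP] : exists w : R, forall k, exists n y, [/\ open (cell_at n y),
    le (hi (cell_at n y)) z, le z (hi (cell_at n y)), vhi (cell_at n y) = embed z &
    vlo (cell_at n y) = embed z - w / 2 ^+ k].
  suff [n [y [op h1 h2 h3]]] : exists n y, [/\ open (cell_at n y),
      le (hi (cell_at n y)) z, le z (hi (cell_at n y)) & vhi (cell_at n y) = embed z].
    exists (embed z - vlo (cell_at n y)).
    elim=> [|k [n' [y' [op' h1' h2' h3' h4']]]].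
      by exists n, y; split=> //; rewrite expr0 divr1 subKr.
    have [m [x [lx xh _ hr]]] := cell_halved op'.
    have [y2 [xy2 y2z]] := dense x (lt_le xh h1').
    exists m, y2; rewrite (hr _ xy2 (lt_le y2z h2')); split=> //=.
    rewrite /mid h3' h4' exprS invfM; lra.
  have [tz|zt] := pselect (le top z).
    have [y [yb yz]] := dense bot bz; exists 0%N, y.
    rewrite /= /start asboolF // asboolF; last by move=> h; apply: yz; apply: preorder_trans h.
    split=> //=.
    by apply/eqP; rewrite -embed_top eq_le; apply/andP; split; apply/embed_le.
  have [n [op xz zx ez]] := cell_closing bz zt.
  have [_ _ /(_ op)[_ lz zh] _] := inside_cell_at n z.
  have [y [ly yz]] := dense _ lz; exists n.+1, y.
  have xh := le_lt xz zh; have lx := lt_le lz zx.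
  rewrite /= (@cell_at_eq n z) //; last by apply: lt_le yz (lt_leW zh).
  by rewrite subcell_lt //; apply: lt_le yz _.
have [k wk] := geometric_small w eps0.
have [n [y [op h1 h2 h3 h4]]] := wP k.
apply: nex; exists y; split.
  by apply: lt_le _ h1; have [_ _ /(_ op)[]] := inside_cell_at n y.
right; have /andP[h _] := embed_bounds n y.
by apply: lt_le_trans h; rewrite h4 ltrD2l ltrN2.
Qed.

(** If the real infimum exceeded [embed z], [embed_right] would give a [y] above [z] that is either
    an immediate successor, so some [g i] below [y] attains [z], or has value below the infimum. For
    empty [S] the approximation hypothesis forces [z] to be a top element, matching the convention
    for [inf01]. *)
Lemma inf01_embed (I : Type) (S : set I) (g : I -> X) z :
  (forall i, S i -> le z (g i)) ->
  (forall y, lt z y -> exists2 i, S i & lt (g i) y) ->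
  inf01 [set embed (g i) | i in S] = embed z.
Proof.
move=> lbz approx; set T := [set _ | _ in _].
have TI a : T a -> 0 <= a <= 1 by move=> [i _ <-]; apply: embed_itv.
have /andP[_ z1] := embed_itv z.
apply/eqP; rewrite eq_le; apply/andP; split; last first.
  by apply: le_inf01 => // _ [i Si <-]; apply/embed_le/lbz.
rewrite leNgt; apply/negP => zT.
have lbT i : S i -> inf01 T <= embed (g i).
  by move=> Si; apply: inf01_lb; [move=> b /TI/andP[]|exists i].
have zt : lt z top.
  move/embed_le; rewrite embed_top leNgt => /negP; apply.
  exact: lt_le_trans zT (inf01_le1 TI).
have [|y [zy hy]] := @embed_right z (inf01 T - embed z) _ zt.
  by rewrite subr_gt0.
have [i Si iy] := approx y zy; have Ti := lbT _ Si.
case: hy => [succ|yT]; last by have := embed_lt iy; lra.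
have /embed_le : le (g i) z by apply: contrapT => /succ.
lra.
Qed.

Lemma sup01_embed (I : Type) (S : set I) (g : I -> X) z :
  (forall i, S i -> le (g i) z) ->
  (forall y, lt y z -> exists2 i, S i & lt y (g i)) ->
  sup01 [set embed (g i) | i in S] = embed z.
Proof.
move=> ubz approx; set T := [set _ | _ in _].
have TI a : T a -> 0 <= a <= 1 by move=> [i _ <-]; apply: embed_itv.
have /andP[z0 _] := embed_itv z.
apply/eqP; rewrite eq_le; apply/andP; split.
  by apply: sup01_le => // _ [i Si <-]; apply/embed_le/ubz.
rewrite leNgt; apply/negP => Tz.
have ubT i : S i -> embed (g i) <= sup01 T.
  by move=> Si; apply: sup01_ub; [move=> b /TI/andP[]|exists i].
have bz : lt bot z.
  move/embed_le; rewrite embed_bot leNgt => /negP; apply.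
  exact: le_lt_trans (sup01_ge0 TI) Tz.
have [|y [yz hy]] := @embed_left z (embed z - sup01 T) _ bz.
  by rewrite subr_gt0.
have [i Si yi] := approx y yz; have Ti := ubT _ Si.
case: hy => [pred|yT]; last by have := embed_lt yi; lra.
have /embed_le : le z (g i) by apply: contrapT => /pred.
lra.
Qed.

End Embedding.

(** * The countermodel *)

Section Countermodel.
Local Open Scope classical_set_scope.
Local Open Scope modal_scope.
Context {R : realType} {V : countType} (P : set extension).
Context (le : nat * modal_form V -> nat * modal_form V -> Prop).
Hypothesis vo : value_order P le.
Hypothesis box_witness : forall v A s, ~ le s (v, Box A) ->
  exists2 w, successor le v w & ~ le s (w, A).
Hypothesis dia_witness : forall v A s, ~ le (v, Dia A) s ->
  exists2 w, successor le v w & ~ le (w, A) s.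

Definition value (s : nat * modal_form V) : R :=
  embed le (0%N, Bot) (0%N, Top) s.

Lemma bot_le s : le (0%N, Bot) s. Proof. exact: vo_bot vo 0%N s. Qed.

Lemma le_top s : le s (0%N, Top). Proof. exact: vo_top vo 0%N s. Qed.

Lemma value_order_nontrivial : ~ le (0%N, Top) (0%N, Bot).
Proof.
have [S [[thS nbS _] leS]] := vo_prime vo 0%N.
by move/leS/(top_imp _ thS).
Qed.

Lemma value_le s t : value s <= value t <-> le s t.
Proof.
exact: embed_le (vo_pre vo) bot_le le_top value_order_nontrivial s t.
Qed.

Lemma value_eq s t : le s t -> le t s -> value s = value t.
Proof.
by move=> st ts; apply/eqP; rewrite eq_le; apply/andP; split; apply/value_le.
Qed.

Lemma value_bot n : value (n, Bot) = 0.
Proof.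
rewrite -(embed_bot (R := R) (vo_pre vo) bot_le le_top value_order_nontrivial).
by apply: value_eq; [exact: vo_bot vo _ _ | exact: bot_le].
Qed.

Lemma value_top n : value (n, Top) = 1.
Proof.
rewrite -(embed_top (R := R) (vo_pre vo) bot_le le_top value_order_nontrivial).
by apply: value_eq; [exact: le_top | exact: vo_top vo _ _].
Qed.

Lemma value_itv s : 0 <= value s <= 1.
Proof.
exact: embed_itv (vo_pre vo) bot_le le_top value_order_nontrivial s.
Qed.

Definition countermodel : crisp_model R V :=
  @CrispModel R V nat (inhabits 0%N) (successor le)
    (fun p n => value (n, Var p)) (fun p n => value_itv (n, Var p)).

(** Except for seriality, the box scheme and the diamond scheme of each pair supply the two halves
    of [successor], by chaining comparisons across worlds. *)
Lemma countermodel_frame x : P x -> frame_condition x (access countermodel).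
Proof.
have [[tr tot] _ _ pr] := vo.
have ext v A B : P x -> ext_axiom x (A ==> B) -> le (v, A) (v, B).
  move=> Px ax; have [S [[thS _ _] leS]] := pr v.
  by apply/leS; apply: thS.1; apply: der_ext ax.
move=> Px0; case: x Px0 ext => Px ext; rewrite /frame_condition /=.
- by move=> v A; split; apply: ext => //; constructor.
- move=> u v w uv vw A; have [uv1 _] := uv (Box A); have [_ uv2] := uv (Dia A).
  have [vw1 vw2] := vw A; split.
    apply: tr (tr _ _ _ _ uv1) vw1; apply: ext => //; constructor.
  by apply: tr vw2 (tr _ _ _ uv2 _); apply: ext => //; constructor.
- move=> v w vw A; have [_ h1] := vw (Box A); have [h2 _] := vw (Dia A); split.
    by apply: tr h1 _; apply: ext => //; constructor.
  by apply: tr _ h2; apply: ext => //; constructor.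
- move=> u v w uv uw A; have [_ h1] := uv (Box A); have [h2 _] := uv (Dia A).
  have [uw1 uw2] := uw A; split.
    by apply: tr h1 (tr _ _ _ _ uw1); apply: ext => //; constructor.
  by apply: tr uw2 (tr _ _ _ _ h2); apply: ext => //; constructor.
(* By [D] the value of [Dia Top] is top, hence not below [Bot], and the witness for this is a
   successor. *)
move=> v; have [|w vw _] := @dia_witness v Top (0%N, Bot); last by exists w.
move=> h; apply: value_order_nontrivial; apply: tr (vo_top vo v _) (tr _ _ _ _ h).
have [S [[thS _ _] leS]] := pr v; apply/leS; apply: (imp_const _ thS).
by apply: thS.1; apply: der_ext (ax_D V).
Qed.

Lemma truth (v : countermodel) A : geval v A = value (v, A).
Proof.
have [[tr tot] _ _ pr] := vo.
elim: A v => /= [p|| A IHA B IHB|A IHA B IHB|A IHA B IHB|A IHA|A IHA] v //.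
- by rewrite value_bot.
- rewrite IHA IHB; have [S [[thS _ _] leS]] := pr v.
  have [ab|ba] := tot (v, A) (v, B).
    rewrite min_l; last exact/value_le.
    apply: value_eq; apply/leS; last exact: theory_ax thS (ax_andl _ _).
    apply: (imp_intro thS) => T thT sub a; apply: (and_intro thT a).
    by apply: (theory_mp thT _ a); apply/sub/leS.
  rewrite min_r; last exact/value_le.
  apply: value_eq; apply/leS; last exact: theory_ax thS (ax_andr _ _).
  apply: (imp_intro thS) => T thT sub b; apply: (and_intro thT _ b).
  by apply: (theory_mp thT _ b); apply/sub/leS.
- rewrite IHA IHB; have [S [[thS _ _] leS]] := pr v.
  have [ab|ba] := tot (v, A) (v, B).
    rewrite max_r; last exact/value_le.
    apply: value_eq; apply/leS; first exact: theory_ax thS (ax_orr _ _).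
    by apply: (or_elim thS); [apply/leS | exact: imp_refl thS].
  rewrite max_l; last exact/value_le.
  apply: value_eq; apply/leS; first exact: theory_ax thS (ax_orl _ _).
  by apply: (or_elim thS); [exact: imp_refl thS | apply/leS].
- rewrite IHA IHB /godel_imp; have [S [pS leS]] := pr v; have [thS _ _] := pS.
  case: ifP => [/value_le/leS ab|nab].
    rewrite -(value_top v); apply: value_eq; last exact: vo_top vo _ _.
    by apply/leS; exact: imp_const thS ab.
  apply: value_eq; apply/leS; first exact: theory_ax thS (ax_k _ _).
  by apply: (prime_imp pS); move/leS/value_le; rewrite nab.
(* Saturation says that [Box A] at [v] is the greatest lower bound, in the abstract order, of [A] at
   the successors; the embedding preserves it. *)
- rewrite [RHS]/value -(inf01_embed (vo_pre vo) bot_le le_top value_order_nontrivial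
    (S := [set w | successor le v w]) (g := fun w => (w, A))).
  + by congr inf01; apply: eq_imagel => w _; apply: IHA.
  + by move=> w /(_ A)[].
  + by move=> s /box_witness[w]; exists w.
- rewrite [RHS]/value -(sup01_embed (vo_pre vo) bot_le le_top value_order_nontrivial
    (S := [set w | successor le v w]) (g := fun w => (w, A))).
  + by congr sup01; apply: eq_imagel => w _; apply: IHA.
  + by move=> w /(_ A)[].
  + by move=> s /dia_witness[w]; exists w.
Qed.

End Countermodel.

Theorem theorem5 (R : realType) (V : countType) (P : set extension)
    (Gamma : set (modal_form V)) (phi : modal_form V) :
  derives P Gamma phi <->
  (forall M : crisp_model R V,
     (forall x, P x -> frame_condition x (access M)) ->
     forall v : M,
       (forall gamma, Gamma gamma -> geval v gamma = 1) -> geval v phi = 1).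
Proof.
split=> [d M fr v|valid]; first exact: soundness d M fr v.
apply: contrapT => /countermodel_order[le [vo leGamma nphi box dia]].
have val1 A : geval (0%N : countermodel (R := R) vo) A = 1 <-> le (0%N, Top) (0%N, A).
  rewrite (truth box dia) -(value_le (R := R) vo) (value_top (R := R) vo).
  have /andP[_ h] := value_itv (R := R) vo (0%N, A).
  by split=> [->//|h']; apply/eqP; rewrite eq_le h h'.
apply: nphi; apply/val1; apply: valid.
  exact: countermodel_frame.
by move=> B GB; apply/val1/leGamma.
Qed.
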